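(* In a multi-unit auction with $m$ identical items, there exists a randomized (universally) obviously strategy-proof mechanism that achieves a $400$-approximation to the optimal social welfare for bidders with decreasing marginal valuations.
   Context: Bidder $i$'s valuation is $v_i:\{0,1,\dots,m\}\to\mathbb{R}_{\ge0}$ with $v_i(0)=0$; it has decreasing marginals if $v_i(j)-v_i(j-1)\ge v_i(j+1)-v_i(j)$ for every $j$ with $1\le j\le m-1$. Valuations are private, the domain is all such valuations, utilities quasi-linear. $\mathrm{OPT}$ is the maximum of $\sum_iv_i(q_i)$ over nonnegative integers with $\sum_iq_i\le m$. A deterministic mechanism is a rooted tree: each internal node is assigned to one bidder, who sends one of the messages labeling the outgoing edges; each leaf is labeled with a feasible allocation and payments. A behavior $B_i$ specifies a message at every node of bidder $i$; a profile $B$ determines a path $\mathrm{Path}(B)$ with allocation $f_i(B)$ and payment $p_i(B)$ for $i$. A strategy $\mathcal S_i$ maps each valuation to a behavior; it is obviously dominant if for every $v_i$, every node $u$ of $i$, every $B_{-i}$ and every profile $B'$ with $u\in\mathrm{Path}(\mathcal S_i(v_i),B_{-i})\cap\mathrm{Path}(B')$ and $B'_i$ sending at $u$ a message different from $\mathcal S_i(v_i)$'s, $v_i(f_i(\mathcal S_i(v_i),B_{-i}))-p_i(\mathcal S_i(v_i),B_{-i})\ge v_i(f_i(B'))-p_i(B')$. A randomized mechanism (distribution over deterministic mechanisms with strategies) is universally OSP if each mechanism in its support is OSP; it gives an $\alpha$-approximation if for every profile $\mathrm{OPT}\le\alpha\,\mathbb{E}[\text{welfare}]$ when bidders follow their strategies.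 *)

(* Defs.v *)
From HB Require Import structures.
From mathcomp Require Import all_boot all_order all_algebra.
From mathcomp Require Import reals.
From Stdlib Require List.
Set Implicit Arguments. Unset Strict Implicit. Unset Printing Implicit Defensive.
Import Order.TTheory GRing.Theory Num.Theory.
Local Open Scope ring_scope.

Section MultiUnit.
Variables (R : realType) (n m : nat).

Definition valuation := 'I_m.+1 -> R.

Definition dm_valuation (v : valuation) : Prop :=
  v ord0 = 0 /\ (forall j, 0 <= v j) /\
  (forall j : nat, (1 <= j)%N -> (j <= m.-1)%N ->
     v (inord j) - v (inord j.-1) >= v (inord j.+1) - v (inord j)).

(* Deterministic mechanism: a well-founded rooted tree.  An internal node is
   assigned to a bidder j and has outgoing edges labelled by the messages of an
   arbitrary type A; a leaf carries an allocation and payments. *)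
Inductive mech : Type :=
| Leaf : ('I_n -> 'I_m.+1) -> ('I_n -> R) -> mech
| Node : 'I_n -> forall A : Type, (A -> mech) -> mech.

Fixpoint feasible (t : mech) : Prop :=
  match t with
  | Leaf f _ => (\sum_(i < n) (f i : nat) <= m)%N
  | Node _ A c => forall a : A, feasible (c a)
  end.

(* A behavior of bidder i: a message at every node of i. *)
Fixpoint beh (i : 'I_n) (t : mech) : Type :=
  match t with
  | Leaf _ _ => unit
  | Node j A c => ((j = i -> A) * (forall a : A, beh i (c a)))%type
  end.

Definition profile (t : mech) := forall k : 'I_n, beh k t.

Fixpoint outcome (t : mech) : profile t -> ('I_n -> 'I_m.+1) * ('I_n -> R) :=
  match t return profile t -> ('I_n -> 'I_m.+1) * ('I_n -> R) with
  | Leaf f p => fun _ => (f, p)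
  | Node j A c => fun B =>
      let a := (B j).1 erefl in @outcome (c a) (fun k => (B k).2 a)
  end.

(* Nodes of a tree, identified by the path from the root. *)
Fixpoint pos (t : mech) : Type :=
  match t with
  | Leaf _ _ => unit
  | Node _ A c => option {a : A & pos (c a)}
  end.

Fixpoint reaches (t : mech) : profile t -> pos t -> Prop :=
  match t return profile t -> pos t -> Prop with
  | Leaf _ _ => fun _ _ => True
  | Node j A c => fun B p =>
      match p with
      | None => True
      | Some (existT a p') =>
          (B j).1 erefl = a /\ @reaches (c a) (fun k => (B k).2 a) p'
      end
  end.

Fixpoint diverge (i : 'I_n) (t : mech) : beh i t -> beh i t -> pos t -> Prop :=
  match t return beh i t -> beh i t -> pos t -> Prop with
  | Leaf _ _ => fun _ _ _ => False
  | Node j A c => fun b b' p =>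
      match p with
      | None => exists e : j = i, b.1 e <> b'.1 e
      | Some (existT a p') => @diverge i (c a) (b.2 a) (b'.2 a) p'
      end
  end.

Definition utility (v : valuation) (i : 'I_n)
  (o : ('I_n -> 'I_m.+1) * ('I_n -> R)) : R := v (o.1 i) - o.2 i.

Record detmech := DetMech {
  dm_tree : mech;
  dm_strat : forall i : 'I_n, valuation -> beh i dm_tree }.

Definition obviously_dominant (t : mech) (i : 'I_n)
    (S : valuation -> beh i t) : Prop :=
  forall v : valuation, dm_valuation v ->
  forall B B' : profile t, B i = S v ->
  forall u : pos t, reaches B u -> reaches B' u -> diverge (B' i) (S v) u ->
    utility v i (outcome B') <= utility v i (outcome B).

Definition OSP (M : detmech) : Prop :=
  feasible (dm_tree M) /\
  forall i : 'I_n, obviously_dominant (@dm_strat M i).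

(* Randomized mechanism: finitely supported distribution over detmechs. *)
Definition randmech := seq (R * detmech).

Definition is_distribution (D : randmech) : Prop :=
  (forall e, List.In e D -> 0 <= e.1) /\ \sum_(e <- D) e.1 = 1.

Definition universally_OSP (D : randmech) : Prop :=
  forall e, List.In e D -> 0 < e.1 -> OSP e.2.

Definition feasible_alloc (q : {ffun 'I_n -> 'I_m.+1}) : bool :=
  (\sum_(i < n) (q i : nat) <= m)%N.

Definition OPT (v : 'I_n -> valuation) : R :=
  \big[Num.max/0]_(q : {ffun 'I_n -> 'I_m.+1} | feasible_alloc q)
     \sum_(i < n) v i (q i).

Definition welfare_of (M : detmech) (v : 'I_n -> valuation) : R :=
  let o := outcome (fun i => @dm_strat M i (v i)) in
  \sum_(i < n) v i (o.1 i).

Definition expected_welfare (D : randmech) (v : 'I_n -> valuation) : R :=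
  \sum_(e <- D) e.1 * welfare_of e.2 v.

Definition approximation (alpha : R) (D : randmech) : Prop :=
  forall v : 'I_n -> valuation, (forall i, dm_valuation (v i)) ->
    OPT v <= alpha * expected_welfare D v.

End MultiUnit.

(* Main.v *)
(** Split the bidders at random into a sample S and its complement T. The
    bidders in S only report their valuations; each bidder in T then buys his
    favourite quantity among the remaining units, one after the other, under a payment rule
    computed from the reports of S, so every bidder faces an offer that does
    not depend on his own messages.

    With probability 1/2 the rule is the unit price OPT(S)/(2m): either all
    units are sold, for revenue OPT(S)/2, or every buyer is satiated and the
    welfare is at least OPT(T) - OPT(S)/2. Exchanging S and T, the average
    welfare of the two splits is at least min(OPT(S), OPT(T))/4, whose
    expectation is at least (OPT - M)/16 for M the largest value of a bidder.

    With probability 1/2 the rule is a flat fee equal to the largest value in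
    S; if the best bidder is strictly best, with probability 1/4 he is in T, the
    second best one is in S, and the best one is the only buyer. In case of a
    tie, both top bidders are separated with constant probability, and already
    the unit price yields a constant fraction of M. *)
Require Import Defs.
From HB Require Import structures.
From mathcomp Require Import all_boot all_order all_algebra.
From mathcomp Require Import boolp reals ring lra zify.
From Stdlib Require List.
Set Implicit Arguments. Unset Strict Implicit. Unset Printing Implicit Defensive.
Import Order.TTheory GRing.Theory Num.Theory.
Local Open Scope ring_scope.

(** * Trees in which bidders report whole valuations in turn *)

Section DirectMechanism.
Variables (R : realType) (n m : nat).
Notation val := (valuation R m).
Notation outc := (('I_n -> 'I_m.+1) * ('I_n -> R))%type.
Variable F : ('I_n -> val) -> outc.

Definition upd (h : 'I_n -> val) i v : 'I_n -> val :=
  fun k => if k == i then v else h k.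

(** [h] records the reports made so far; a bidder still to be asked keeps a placeholder, overwritten
    at his turn. *)
Fixpoint direct (s : seq 'I_n) (h : 'I_n -> val) : mech R n m :=
  match s with
  | [::] => Leaf (F h).1 (F h).2
  | j :: s' => Node j (fun v : val => direct s' (upd h j v))
  end.

Fixpoint truth (i : 'I_n) (v : val) s : forall h, beh i (direct s h) :=
  match s return forall h, beh i (direct s h) with
  | [::] => fun _ => tt
  | j :: s' => fun h => (fun _ => v, fun a => truth i v s' (upd h j a))
  end.

(** [h] and [h'] share the reports that precede the turn of [i] and are otherwise arbitrary, so the
    worst outcome of an honest report is compared with the best outcome of any other one. *)
Fixpoint truthful (s : seq 'I_n) : Prop :=
  match s with
  | [::] => True
  | i :: s' =>
      (forall h h' : 'I_n -> val, (forall k, k \notin i :: s' -> h k = h' k) ->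
         dm_valuation (h i) ->
         utility (h i) i (F h') <= utility (h i) i (F h)) /\ truthful s'
  end.

Lemma feasible_direct s h :
  (forall h, (\sum_(i < n) ((F h).1 i : nat) <= m)%N) -> feasible (direct s h).
Proof. by move=> Ff; elim: s h => [|j s IHs] h //= a; apply: IHs. Qed.

Lemma outcome_direct s h (B : profile (direct s h)) :
  exists2 h', outcome B = F h' & forall k, k \notin s -> h' k = h k.
Proof.
elim: s h B => [|j s IHs] h B /=; first by exists h => //; case: (F h).
have [h' -> eqh] := IHs _ (fun k => (B k).2 ((B j).1 erefl)).
exists h' => // k; rewrite inE negb_or => /andP[kj ks].
by rewrite eqh // /upd (negPf kj).
Qed.

Lemma outcome_truth s h (v : 'I_n -> val) : (forall k, k \in s) ->
  outcome (fun k => truth k (v k) s h) = F v.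
Proof.
move=> sT; suff: outcome (fun k => truth k (v k) s h) =
    F (fun k => if k \in s then v k else h k).
  by move=> ->; congr F; apply/funext => k; rewrite sT.
elim: s h {sT} => [|j s IHs] h /=; first by case: (F h).
rewrite IHs; congr F; apply/funext => k; rewrite inE /upd.
by case: (k =P j) => [->|_] /=; case: ifP.
Qed.

(** Profiles that reach the same node have the same history, so their report vectors agree outside
    the bidders still to speak. Uniqueness of [s] keeps the report of [i] from being overwritten
    later. *)
Lemma direct_obviously_dominant s h i :
  uniq s -> truthful s -> obviously_dominant (fun v => truth i v s h).
Proof.
move=> + + v dmv; elim: s h => [|j s IHs] h //= /andP[js us] [tj ts] B B' Bi.
case=> [[a p]|] /=.
  move=> [Ba Bp] [Ba' Bp'] dv; rewrite Ba Ba'.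
  by apply: (IHs _ us ts _ _ _ p) => //; rewrite Bi.
move=> _ _ [ji _]; case: i / ji {IHs} Bi => Bj.
have [h1 -> h1E] := outcome_direct (fun k => (B k).2 ((B j).1 erefl)).
have [h2 -> h2E] := outcome_direct (fun k => (B' k).2 ((B' j).1 erefl)).
have h1j : h1 j = v by rewrite h1E // /upd eqxx Bj.
rewrite -h1j; apply: tj; last by rewrite h1j.
move=> k; rewrite inE negb_or => /andP[kj ks].
by rewrite h1E // h2E // /upd (negPf kj).
Qed.

End DirectMechanism.

(** * Sequential sale of a limited supply under a payment rule *)

Section SequentialSale.
Variables (R : realType) (n m : nat).
Notation val := (valuation R m).
Implicit Types (pi : 'I_m.+1 -> R) (q : 'I_m.+1) (v : val) (h : 'I_n -> val).

Definition unit_price (p : R) q : R := p * (q : nat)%:R.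

Definition entry_fee (P : R) q : R := if q == ord0 then 0 else P.

(** Indifference is resolved towards buying nothing, so a bidder whose values do not exceed an entry
    fee leaves the supply untouched. *)
Definition demand pi v (r : nat) : 'I_m.+1 :=
  let q := [arg max_(q > (ord0 : 'I_m.+1) | (q <= r)%N) (v q - pi q)]%O in
  if 0 < v q - pi q then q else ord0.

Lemma demand_le pi v r : (demand pi v r <= r)%N.
Proof. by rewrite /demand; case: arg_maxP => //= q qr _; case: ifP. Qed.

Lemma demand_max pi v r q : v ord0 = 0 -> pi ord0 = 0 -> (q <= r)%N ->
  v q - pi q <= v (demand pi v r) - pi (demand pi v r).
Proof.
move=> v0 p0 qr; rewrite /demand; case: arg_maxP => //= q' _ /(_ q qr).
case: ltP => // q'0 /le_trans; apply.
by rewrite v0 p0 subrr.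
Qed.

Lemma demand0 pi v r : (forall q, v q <= pi q) -> demand pi v r = ord0.
Proof.
by move=> vp; rewrite /demand; case: ifP => //; rewrite subr_gt0 ltNge vp.
Qed.

(** Marginals beyond the one at [q] are no larger, hence at most [p]; [k] of them telescope. *)
Lemma dm_marginals v (p : R) (q k : nat) : dm_valuation v ->
  v (inord q.+1) - v (inord q) <= p -> (q + k <= m)%N ->
  v (inord (q + k)) - v (inord q) <= p * k%:R.
Proof.
move=> [_ [_ dm]] vq qm.
have step j : (q + j < m)%N -> v (inord (q + j).+1) - v (inord (q + j)) <= p.
  elim: j => [|j IHj] jm; first by rewrite addn0.
  rewrite addnS in jm *; apply: le_trans (IHj _); last lia.
  by apply: (dm (q + j).+1) => //; lia.
elim: k qm => [|k IHk] qm; first by rewrite addn0 subrr mulr0.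
have := step k; rewrite -addnS => /(_ ltac:(lia)).
by have := IHk ltac:(lia); rewrite -natr1; lra.
Qed.

(* By concavity a local optimum is global, so a buyer who leaves some units
   unbought is not constrained by the supply. *)
Lemma demand_unconstrained v (p : R) r q : dm_valuation v ->
  (demand (unit_price p) v r < r)%N ->
  v q - p * (q : nat)%:R <=
  v (demand (unit_price p) v r)
   - p * (demand (unit_price p) v r : nat)%:R.
Proof.
move=> dmv; set pi := unit_price p; set c := demand _ _ _ => cr.
have v0 : v ord0 = 0 by case: dmv.
have pi0 : pi ord0 = 0 by rewrite /pi /unit_price mulr0.
have max q' : (q' <= r)%N -> v q' - pi q' <= v c - pi c by apply: demand_max.
have [qc|cq] := leqP q c; first by apply: max; lia.
have qm := ltn_ord q.
have c1 : nat_of_ord (inord c.+1 : 'I_m.+1) = c.+1 by rewrite inordK //; lia.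
have := max (inord c.+1); rewrite /pi /unit_price c1 => /(_ cr) mc.
have := @dm_marginals v p c (q - c) dmv; rewrite subnKC; last lia.
rewrite !inord_val natrB; last lia.
by move: mc; rewrite -natr1 => mc /(_ ltac:(lra) ltac:(lia)); lra.
Qed.

Fixpoint sale pi h (l : seq 'I_n) (r : nat) (i : 'I_n) : 'I_m.+1 :=
  match l with
  | [::] => ord0
  | j :: l' => let q := demand pi (h j) r in
               if i == j then q else sale pi h l' (r - q) i
  end.

Lemma sale_notin pi h l r i : i \notin l -> sale pi h l r i = ord0.
Proof.
elim: l r => //= j l IHl r; rewrite inE negb_or => /andP[/negPf-> il].
exact: IHl.
Qed.

Lemma sale_feasible pi h l r : (\sum_(i < n) (sale pi h l r i : nat) <= r)%N.
Proof.
elim: l r => [|j l IHl] r /=; first by rewrite big1.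
set q := demand _ _ _.
apply: (@leq_trans (\sum_(i < n) ((if i == j then q : nat else 0)
    + sale pi h l (r - q) i))).
  by apply: leq_sum => i _; case: ifP => _; rewrite ?leq_addr.
by rewrite big_split /= -big_mkcond big_pred1_eq -leq_subRL ?IHl // demand_le.
Qed.

(** The supply left for [i] is fixed by the buyers served before him. *)
Lemma sale_prefix pi h h' l i l' r :
  (forall k, k \in l -> h k = h' k) -> i \notin l ->
  exists r', sale pi h (l ++ i :: l') r i = demand pi (h i) r' /\
             sale pi h' (l ++ i :: l') r i = demand pi (h' i) r'.
Proof.
elim: l r => [|j l IHl] r hh /=; first by exists r; rewrite eqxx.
rewrite inE negb_or => /andP[/negPf-> il].
rewrite -(hh j) ?mem_head //; apply: IHl => // k kl.
by apply: hh; rewrite inE kl orbT.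
Qed.

Definition sold pi h l r := \sum_(i < n) h i (sale pi h l r i).

Lemma sold_cons pi h j l r : (forall i, h i ord0 = 0) -> j \notin l ->
  sold pi h (j :: l) r =
  h j (demand pi (h j) r) + sold pi h l (r - demand pi (h j) r).
Proof.
move=> h0 jl; rewrite /sold (bigD1 j) //= eqxx.
rewrite [in RHS](bigD1 j) //= (sale_notin _ _ _ jl) h0 add0r; congr (_ + _).
by apply: eq_bigr => i /negPf->.
Qed.

Lemma sold_ge0 pi h l r : (forall i, dm_valuation (h i)) -> 0 <= sold pi h l r.
Proof. by move=> dmh; apply: sumr_ge0 => i _; case: (dmh i) => _ []. Qed.

(** If the supply runs out, welfare covers the revenue [p * r], as each buyer values his purchase at
    least at its price. Otherwise no buyer is constrained, and each has at least the surplus that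
    [o] would give him at price [p]. *)
Lemma sold_posted (p : R) h l r (o : 'I_n -> 'I_m.+1) :
  0 <= p -> (forall i, dm_valuation (h i)) -> uniq l ->
  p * r%:R <= sold (unit_price p) h l r \/
  \sum_(i <- l) (h i (o i) - p * (o i : nat)%:R)
    <= sold (unit_price p) h l r.
Proof.
move=> p0 dmh; have h0 i : h i ord0 = 0 by case: (dmh i).
elim: l r => [|j l IHl] r /=; first by right; rewrite big_nil sold_ge0.
set pi := unit_price p => /andP[jl ul]; rewrite sold_cons // big_cons.
set q := demand _ _ _.
have qr : (q <= r)%N by apply: demand_le.
have pq0 : 0 <= p * (q : nat)%:R by rewrite mulr_ge0.
have qp : p * (q : nat)%:R <= h j q.
  have := @demand_max pi (h j) r ord0 (h0 j); rewrite /pi /unit_price mulr0 h0 subr0.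
  by move=> /(_ erefl (leq0n _)); rewrite subr_ge0.
have [qr'|rq] := ltnP q r; last first.
  have -> : r = q by lia.
  by left; have := sold_ge0 pi l (q - q) dmh; lra.
have := demand_unconstrained (o j) (dmh j) qr'; rewrite -/pi -/q => max.
case: (IHl (r - q)%N ul) => IH; [left|right].
  by move: IH; rewrite natrB // -/pi; lra.
by move: IH; rewrite -/pi; lra.
Qed.

(** The others decline the fee, so [i] meets the full supply; a flat fee does not distort his choice
    among positive quantities. *)
Lemma sold_entry_fee (P : R) h l r i q :
  (forall i, dm_valuation (h i)) -> uniq l -> i \in l -> 0 <= P ->
  (forall j, j \in l -> j != i -> forall q, h j q <= P) -> P < h i q ->
  (q <= r)%N ->
  h i q <= sold (entry_fee P) h l r.
Proof.
move=> dmh + + P0 + Pq qr; have h0 j : h j ord0 = 0 by case: (dmh j).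
set pi := entry_fee P.
elim: l => [|j l IHl] //= /andP[jl ul] il small; rewrite sold_cons //.
have [ij|ij] := eqVneq i j; last first.
  rewrite demand0 => [|q']; last first.
    rewrite /pi /entry_fee; case: eqP => [->|_]; first by rewrite h0.
    by apply: small; rewrite ?mem_head // eq_sym.
  rewrite h0 add0r subn0; apply: IHl => //.
    by move: il; rewrite inE (negPf ij).
  by move=> k kl; apply: small; rewrite inE kl orbT.
rewrite -ij; have := @demand_max pi (h i) r q (h0 i) erefl qr.
set c := demand _ _ _; have := sold_ge0 pi l (r - c) dmh.
rewrite /pi /entry_fee; case: (q =P ord0) => [q0|_].
  by move: Pq; rewrite q0 h0 => /(le_lt_trans P0); rewrite ltxx.
(* Buying nothing would give [i] utility 0, below [h i q - P]. *)
case: (c =P ord0) => [->|_]; rewrite ?h0; lra.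
Qed.

End SequentialSale.

(** * Counting over uniformly random subsets *)

Section RandomSplit.
Variables (R : realType) (T : finType).

(** Forcing [i] in and [j] out sends any subset into [G]. One of four maps undoes the change, one
    per membership pattern of [i] and [j], so four images of [G] cover all subsets. *)
Lemma card_separating (i j : T) : i != j ->
  (#|{set T}| <= 4 * #|[set S : {set T} | (i \in S) && (j \notin S)]|)%N.
Proof.
move=> ij; set G := [set S : {set T} | _].
have : [set: {set T}] \subset
    (G :|: [set S :\ i | S in G]) :|:
    ([set j |: S | S in G] :|: [set (j |: S) :\ i | S in G]).
  apply/subsetP => S _; set X := (i |: S) :\ j.
  have XG : X \in G by rewrite !inE eqxx (negPf ij) eqxx.
  have imX (f : {set T} -> {set T}) : f X = S -> S \in [set f Y | Y in G].
    by move=> <-; apply: imset_f.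
  case iS: (i \in S); case jS: (j \in S); rewrite !in_setU.
  - rewrite [S \in [set j |: _ | _ in _]]imX ?orbT //.
    by rewrite /X setD1K ?inE ?jS ?orbT //; apply/setUidPr; rewrite sub1set.
  - by rewrite inE iS jS.
  - rewrite [S \in [set (j |: _) :\ i | _ in _]]imX ?orbT //.
    by rewrite /X setD1K ?inE ?jS ?orbT // setU1K ?iS.
  - rewrite [S \in [set _ :\ i | _ in _]]imX ?orbT //.
    apply/setP => k; rewrite /X !inE.
    by case: eqP => [->|_] //=; case: eqP => [->|].
move=> /subset_leq_card; rewrite cardsT => /leq_trans; apply.
have im (f : {set T} -> {set T}) : (#|[set f S | S in G]| <= #|G|)%N.
  exact: leq_imset_card.
apply: leq_trans (leq_card_setU _ _) _; rewrite mulSn mulSn mul2n -addnn addnA.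
by apply: leq_add; apply: leq_trans (leq_card_setU _ _) _; rewrite leq_add ?im.
Qed.

Lemma sum_separating (F : {set T} -> R) (i j : T) (c : R) : i != j ->
  0 <= c -> (forall S, 0 <= F S) ->
  (forall S : {set T}, i \in S -> j \notin S -> c <= F S) ->
  #|{set T}|%:R * c <= 4 * \sum_S F S.
Proof.
move=> ij c0 F0 Fc; set G := [set S : {set T} | (i \in S) && (j \notin S)].
have GF : #|G|%:R * c <= \sum_S F S.
  rewrite mulr_natl -sumr_const big_mkcond /=; apply: ler_sum => S _.
  by case: ifP => //; rewrite inE => /andP[iS jS]; apply: Fc.
have : (#|{set T}|%:R : R) <= 4 * #|G|%:R.
  by rewrite -(natrM _ 4) ler_nat card_separating.
by move=> /(ler_wpM2r c0); lra.
Qed.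

Lemma sum_min_split (a : T -> R) (M : R) : 0 <= M ->
  (forall i, 0 <= a i <= M) ->
  #|{set T}|%:R * (\sum_i a i - M) <=
  4 * \sum_(S : {set T}) Num.min (\sum_(i in S) a i) (\sum_(i in ~: S) a i).
Proof.
move=> M0 aM; have a0 i : 0 <= a i by case/andP: (aM i).
set A := \sum_i a i; have A0 : 0 <= A by apply: sumr_ge0.
set N : R := _%:R; have N0 : 0 <= N by rewrite ler0n.
have sA (S : {set T}) : \sum_(i in S) a i + \sum_(i in ~: S) a i = A.
  rewrite /A [RHS](bigID (mem S)) /=; congr (_ + _).
  by apply: eq_bigl => i; rewrite inE.
have s0 (S : {set T}) : 0 <= \sum_(i in S) a i by apply: sumr_ge0.
have [Apos|Aneg] := ltP 0 A; last first.
  apply: (@le_trans _ _ 0); last first.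
    by rewrite mulr_ge0 // sumr_ge0 // => S _; rewrite le_min !s0.
  by rewrite mulr_ge0_le0 //; lra.
rewrite -(ler_pM2r Apos) -mulrA -mulrA mulr_suml.
(* min(x, y) (x + y) >= x y, and the expectation of the product only involves
   pairs separated by [S]. *)
apply: (@le_trans _ _ (4 * \sum_(S : {set T})
   ((\sum_(i in S) a i) * (\sum_(i in ~: S) a i)))); last first.
  rewrite ler_pM2l //; apply: ler_sum => S _; rewrite -(sA S).
  have := s0 S; have := s0 (~: S).
  set x := \sum_(i in S) _; set y := \sum_(i in ~: S) _ => y0 x0.
  by case: (leP x y) => xy; nra.
have -> : \sum_(S : {set T}) (\sum_(i in S) a i) * (\sum_(i in ~: S) a i) =
    \sum_i \sum_j \sum_(S : {set T})
      (if (i \in S) && (j \notin S) then a i * a j else 0).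
  under [RHS]eq_bigr do rewrite exchange_big.
  rewrite exchange_big; apply: eq_bigr => S _.
  rewrite mulr_suml big_mkcond; apply: eq_bigr => i _.
  case: ifP => iS /=; last by rewrite big1.
  rewrite mulr_sumr big_mkcond; apply: eq_bigr => j _.
  by rewrite inE.
have -> : N * ((A - M) * A) = \sum_i N * (a i * (A - M)).
  by rewrite -mulr_sumr -mulr_suml -/A [A * _]mulrC.
rewrite mulr_sumr.
apply: ler_sum => i _.
(* Since [a i <= M], dropping the diagonal term [a i * a i] costs at most [a i * M]. *)
apply: (@le_trans _ _ (\sum_(j | j != i) N * (a i * a j))).
  rewrite -mulr_sumr -mulr_sumr ler_wpM2l // ler_wpM2l //.
  by rewrite /A (bigD1 i) //=; case/andP: (aM i); lra.
rewrite big_mkcond mulr_sumr; apply: ler_sum => j _.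
have aij : 0 <= a i * a j by rewrite mulr_ge0.
case: eqP => [_|/eqP ji] /=.
  by rewrite mulr_ge0 // sumr_ge0 // => S _; case: ifP.
apply: (sum_separating (i := i) (j := j)) => // [||S iS jS].
- by rewrite eq_sym.
- by move=> S; case: ifP.
- by rewrite iS jS.
Qed.

End RandomSplit.

(** * The sampling mechanisms: truthfulness and welfare *)

Section SamplingMechanism.
Variables (R : realType) (n m : nat).
Notation val := (valuation R m).
Implicit Types (S : {set 'I_n}) (h v : 'I_n -> val).

Definition payment_rule := {set 'I_n} -> ('I_n -> val) -> 'I_m.+1 -> R.

Definition sample_based (rule : payment_rule) :=
  (forall S h, rule S h ord0 = 0) /\
  forall S h h', (forall i, i \in S -> h i = h' i) -> rule S h = rule S h'.

Definition sampling_sale (rule : payment_rule) S h :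
    ('I_n -> 'I_m.+1) * ('I_n -> R) :=
  let q := sale (rule S h) h (enum (~: S)) m in (q, fun i => rule S h (q i)).

(** Sampled bidders speak first and buyers in the order of the sale, so the payment rule and the
    remaining supply are settled when a buyer speaks. The zero valuations are placeholders, all
    overwritten. *)
Definition sampling_mech (rule : payment_rule) S : detmech R n m :=
  DetMech (fun i u => truth (sampling_sale rule S) i u
                        (enum S ++ enum (~: S)) (fun _ _ => 0)).

(** A sampled bidder gets and pays nothing whatever he reports; the report of a buyer only selects
    from a menu that is already fixed. *)
Lemma sampling_sale_truthful rule S : sample_based rule ->
  truthful (sampling_sale rule S) (enum S ++ enum (~: S)).
Proof.
move=> [rule0 ruleS].
(* Generalised to suffixes, so that [t1] collects the buyers already served. *)
have : forall t1 t, enum (~: S) = t1 ++ t ->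
    truthful (sampling_sale rule S) t.
  move=> t1 t; elim: t t1 => [|i t IHt] t1 //= eqt; split; last first.
    by apply: (IHt (rcons t1 i)); rewrite cat_rcons.
  move=> h h' hh dmh.
  have : uniq (t1 ++ i :: t) by rewrite -eqt enum_uniq.
  rewrite cat_uniq => /and3P[_ /hasPn disj _].
  have nS k : k \in S -> k \notin i :: t.
    move=> kS; apply/negP => kt.
    have : k \in enum (~: S) by rewrite eqt mem_cat kt orbT.
    by rewrite mem_enum inE kS.
  have nt1 k : k \in t1 -> k \notin i :: t.
    by apply: contraTN => /disj.
  have it1 : i \notin t1 by apply: disj; rewrite mem_head.
  have [r [E E']] := sale_prefix (rule S h) t m
    (fun k kt => hh k (nt1 k kt)) it1.
  rewrite /utility /sampling_sale /= eqt.
  rewrite -(ruleS S h h' (fun k kS => hh k (nS k kS))) E E'.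
  apply: demand_max => //; first by case: dmh.
  by apply: leq_trans (demand_le _ _ _) _.
move=> /(_ [::] _ erefl) tT.
have : {subset enum S <= S} by move=> i; rewrite mem_enum.
elim: (enum S) => [|i s IHs] //= sS; split; last first.
  by apply: IHs => k ks; apply: sS; rewrite inE ks orbT.
move=> h h' _ _; rewrite /utility /sampling_sale /= !sale_notin ?rule0 //.
all: by rewrite mem_enum inE sS ?mem_head.
Qed.

Lemma sampling_mech_OSP rule S : sample_based rule -> OSP (sampling_mech rule S).
Proof.
move=> rS; split=> [|i].
  by apply: feasible_direct => h; apply: sale_feasible.
apply: direct_obviously_dominant; last exact: sampling_sale_truthful.
rewrite cat_uniq !enum_uniq andbT /=; apply/hasPn => k.
by rewrite !mem_enum inE.
Qed.

Lemma sampling_mech_welfare rule S v :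
  welfare_of (sampling_mech rule S) v = sold (rule S v) v (enum (~: S)) m.
Proof.
rewrite /welfare_of /= outcome_truth // => k.
by rewrite mem_cat !mem_enum inE orbN.
Qed.

(** Units given outside [S] count for nothing, so [S] competes for the full supply. *)
Definition sample_OPT S h : R :=
  \big[Num.max/0]_(q : {ffun 'I_n -> 'I_m.+1} | feasible_alloc q)
    \sum_(i in S) h i (q i).

(** All quantities are compared because valuations need not be monotone; the default 0 makes the fee
    vanish for an empty sample. *)
Definition sample_max S h : R :=
  \big[Num.max/0]_(x : 'I_n * 'I_m.+1 | x.1 \in S) h x.1 x.2.

Lemma le_sample_max S h i q : i \in S -> h i q <= sample_max S h.
Proof.
move=> iS; exact: (le_bigmax_cond 0 (P := fun x : 'I_n * 'I_m.+1 => x.1 \in S)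
  (fun x => h x.1 x.2) (j := (i, q))).
Qed.

(* When [m = 0] the price is [0], and so is [sample_OPT]. *)
Definition posted_rule : payment_rule :=
  fun S h => unit_price (sample_OPT S h / (2 * m%:R)).

Definition fee_rule : payment_rule := fun S h => entry_fee (sample_max S h).

Lemma posted_rule_sample_based : sample_based posted_rule.
Proof.
split=> [S h|S h h' hh]; first by rewrite /posted_rule /unit_price mulr0.
rewrite /posted_rule /sample_OPT; congr (unit_price (_ / _)).
by apply: eq_bigr => q _; apply: eq_bigr => i iS; rewrite hh.
Qed.

Lemma fee_rule_sample_based : sample_based fee_rule.
Proof.
split=> // S h h' hh; congr entry_fee.
by apply: eq_bigr => x xS; rewrite hh.
Qed.

Lemma sample_OPT_ge0 S h : 0 <= sample_OPT S h.
Proof. exact: bigmax_ge_id. Qed.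

Lemma le_sample_OPT S h (q : {ffun 'I_n -> 'I_m.+1}) : feasible_alloc q ->
  \sum_(i in S) h i (q i) <= sample_OPT S h.
Proof. exact: le_bigmax_cond. Qed.

Lemma le_sample_OPT1 S h i q : (forall j, h j ord0 = 0) -> i \in S ->
  h i q <= sample_OPT S h.
Proof.
move=> h0 iS; pose o := [ffun k => if k == i then q else (ord0 : 'I_m.+1)].
apply: le_trans (le_sample_OPT S h (q := o) _).
  rewrite (bigD1 i) //= ffunE eqxx big1 ?addr0 // => k /andP[_ /negPf ki].
  by rewrite ffunE ki h0.
rewrite /feasible_alloc (bigD1 i) //= ffunE eqxx big1 ?addn0 => [|k /negPf ki].
  by rewrite -ltnS.
by rewrite ffunE ki.
Qed.

(** Half of [sample_OPT S v] is [p * m]: the revenue if everything is sold, and a bound on the cost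
    at price [p] of any feasible allocation. *)
Lemma posted_welfare S v : (forall i, dm_valuation (v i)) ->
  let W := welfare_of (sampling_mech posted_rule S) v in
  sample_OPT S v / 2 <= W \/ sample_OPT (~: S) v - sample_OPT S v / 2 <= W.
Proof.
move=> dmv; rewrite /= sampling_mech_welfare /posted_rule.
set p := _ / (2 * _); set W := sold _ _ _ _.
have W0 : 0 <= W by apply: sold_ge0.
have p0 : 0 <= p by rewrite mulr_ge0 ?sample_OPT_ge0 // invr_ge0 mulr_ge0.
have pm : p * m%:R = sample_OPT S v / 2.
  have [m0|m0] := posnP m; last first.
    by rewrite /p; field; rewrite pnatr_eq0; lia.
  suff -> : sample_OPT S v = 0 by rewrite [in LHS]m0 mulr0 mul0r.
  apply/le_anti; rewrite sample_OPT_ge0 andbT.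
  apply: bigmax_le => // q _; rewrite big1 // => i _.
  have qm : (q i <= m)%N by rewrite -ltnS.
  have -> : q i = ord0 by apply/ord_inj/eqP; rewrite -leqn0 (leq_trans qm) ?m0.
  by case: (dmv i).
(* [sold_posted] decides between its alternatives separately for each allocation; excluding the
   first one beforehand leaves the second for every [q]. *)
have [sW|sW] := leP (sample_OPT S v / 2) W; [by left|right].
rewrite lerBlDr; apply: bigmax_le => [|q fq]; first by rewrite -pm; nra.
have ul : uniq (enum (~: S)) by apply: enum_uniq.
case: (sold_posted m q p0 dmv ul); rewrite -/W ?pm; first lra.
rewrite big_enum /= sumrB -mulr_sumr -natr_sum.
have : (\sum_(i in ~: S) (q i : nat) <= m)%N.
  apply: leq_trans fq; rewrite [leqRHS](bigID (mem (~: S))) /=.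
  exact: leq_addr.
rewrite -(ler_nat R) => /(ler_wpM2l p0); rewrite pm; lra.
Qed.

(** Sample the side with the smaller optimum [x], leaving [y >= x] on the other: both [x / 2] and
    [y - x / 2] are at least [x / 2]. *)
Lemma posted_welfare_sum v : (forall i, dm_valuation (v i)) ->
  \sum_S Num.min (sample_OPT S v) (sample_OPT (~: S) v) <=
  4 * \sum_S welfare_of (sampling_mech posted_rule S) v.
Proof.
move=> dmv; pose W S := welfare_of (sampling_mech posted_rule S) v.
have W0 S : 0 <= W S by rewrite /W sampling_mech_welfare sold_ge0.
rewrite -[leRHS]/(4 * \sum_S W S).
have -> : 4 * \sum_S W S = \sum_S 2 * (W S + W (~: S)).
  rewrite -mulr_sumr big_split /=.
  rewrite -[X in _ + X](reindex_inj (h := @setC _) (P := xpredT) (F := W)) /=.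
    by ring.
  exact: setC_inj.
apply: ler_sum => S _.
have := posted_welfare S dmv; have := posted_welfare (~: S) dmv.
rewrite /= setCK -/(W S) -/(W (~: S)); have := W0 S; have := W0 (~: S).
by case: (leP (sample_OPT S v) (sample_OPT (~: S) v)) => ? ? ? [?|?] [?|?]; lra.
Qed.

Lemma fee_welfare S v i q : (forall j, dm_valuation (v j)) -> i \notin S ->
  (forall j, j != i -> forall q', v j q' <= sample_max S v) ->
  sample_max S v < v i q ->
  v i q <= welfare_of (sampling_mech fee_rule S) v.
Proof.
move=> dmv iS small large; rewrite sampling_mech_welfare.
apply: sold_entry_fee => //.
- exact: enum_uniq.
- by rewrite mem_enum inE.
- exact: bigmax_ge_id.
- by move=> j _; apply: small.
- by rewrite -ltnS.
Qed.

Lemma fee_welfare_sum v i q : (forall j, dm_valuation (v j)) ->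
  (forall j, j != i -> forall q', v j q' < v i q) ->
  #|{set 'I_n}|%:R * v i q <=
  4 * \sum_S welfare_of (sampling_mech fee_rule S) v.
Proof.
move=> dmv large.
have W0 S : 0 <= welfare_of (sampling_mech fee_rule S) v.
  by rewrite sampling_mech_welfare sold_ge0.
have vi0 : 0 <= v i q by case: (dmv i) => _ [].
(* The maximum defaults to 0, so a strict bound on it needs [v i q] positive. *)
have [->|vi] := eqVneq (v i q) 0; first by rewrite mulr0 mulr_ge0 ?sumr_ge0.
have vlt S : i \notin S -> sample_max S v < v i q.
  move=> iS; apply: bigmax_lt => [|x xS]; first by rewrite lt_def vi.
  by apply: large; apply: contraNneq iS => <-.
(* A lone bidder has no rival to be separated from: there are two splits, and the empty sample
   suffices. *)
have [/existsP[j0 j0i]|/existsPn noj] := boolP [exists j, j != i]; last first.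
  have only S : i \notin S -> v i q <= welfare_of (sampling_mech fee_rule S) v.
    move=> iS; apply: fee_welfare (vlt _ iS) => // j ji.
    by have := noj j; rewrite ji.
  have -> : #|{set 'I_n}| = 2.
    rewrite -cardsT -powersetT card_powerset cardsT card_ord.
    have -> // : n = 1%N.
    rewrite -(card_ord n); apply/eqP/fintype1P.
    by exists i => j; apply/eqP; have := noj j; rewrite negbK.
  have := only set0; rewrite inE => /(_ isT).
  rewrite (bigD1 set0) //=.
  have : 0 <= \sum_(S | S != set0) welfare_of (sampling_mech fee_rule S) v.
    by apply: sumr_ge0.
  by lra.
(* The runner-up: once sampled, he raises the fee to a level no bidder other than [i] exceeds. *)
pose top := [arg max_(x > (j0, ord0 : 'I_m.+1) | x.1 != i) v x.1 x.2]%O.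
have [topi topmax] : top.1 != i /\
    forall j, j != i -> forall q', v j q' <= v top.1 top.2.
  rewrite /top; case: arg_maxP => //= x xi xmax; split=> // j ji q'.
  exact: (xmax (j, q')).
apply: (sum_separating (i := top.1) (j := i)) => // S topS iS.
apply: fee_welfare (vlt _ iS) => // j ji q'.
apply: le_trans (topmax j ji q') _.
exact: le_sample_max.
Qed.

(** With [A] the value of [o], [N * (A - M) <= 4 * mOPT <= 16 * P] and [N * M <= 16 * P + 4 * Q],
    hence [N * A <= 32 * P + 4 * Q]. *)
Lemma sampling_welfare v (o : {ffun 'I_n -> 'I_m.+1}) :
  (forall i, dm_valuation (v i)) -> feasible_alloc o ->
  #|{set 'I_n}|%:R * \sum_i v i (o i) <=
  32 * (\sum_S welfare_of (sampling_mech posted_rule S) v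
        + \sum_S welfare_of (sampling_mech fee_rule S) v).
Proof.
move=> dmv fo; have v0 i : v i ord0 = 0 by case: (dmv i).
have vge0 i q : 0 <= v i q by case: (dmv i) => _ [].
have := posted_welfare_sum dmv; set mOPT := \sum_S Num.min _ _.
set P := \sum_S _; set Q := \sum_S welfare_of (sampling_mech fee_rule S) v.
move=> mP.
have Q0 : 0 <= Q.
  by apply: sumr_ge0 => S _; rewrite sampling_mech_welfare sold_ge0.
have P0 : 0 <= P.
  by apply: sumr_ge0 => S _; rewrite sampling_mech_welfare sold_ge0.
have [/existsP[i0 _]|/existsPn noi] := boolP [exists i : 'I_n, true]; last first.
  rewrite big1 => [|i]; last by have := noi i.
  by rewrite mulr0 mulr_ge0 // addr_ge0.
pose top := [arg max_(x > (i0, ord0 : 'I_m.+1) | true) v x.1 x.2]%O.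
have topmax i q : v i q <= v top.1 top.2.
  by rewrite /top; case: arg_maxP => //= x _ xmax; apply: (xmax (i, q)).
set N : R := _%:R; set M := v top.1 top.2.
have NA : N * (\sum_i v i (o i) - M) <= 4 * mOPT.
  apply: le_trans (sum_min_split (vge0 _ _) _) _ => [i|].
    by rewrite vge0 topmax.
  rewrite ler_pM2l //; apply: ler_sum => S _.
  by rewrite le_min !ge_min !le_sample_OPT ?orbT.
suff NM : N * M <= 16 * P + 4 * Q by lra.
(* In a tie at [M], both optima are at least [M] whenever the two bidders are separated; otherwise
   the top bidder is strictly best and the fee applies. *)
have [/existsP[j /andP[ji /existsP[q vq]]]|] :=
    boolP [exists j, (j != top.1) && [exists q, M <= v j q]].
  have : N * M <= 4 * mOPT; last by lra.
  apply: (sum_separating (i := j) (j := top.1)) => // [||S jS iS].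
  - exact: vge0.
  - by move=> S; rewrite le_min !sample_OPT_ge0.
  - rewrite le_min (le_trans vq) ?le_sample_OPT1 //.
    by rewrite inE.
move=> /existsPn strict.
have : N * M <= 4 * Q; last by lra.
apply: fee_welfare_sum => // j ji q'.
by have := strict j; rewrite ji /= => /existsPn/(_ q'); rewrite -ltNge.
Qed.

End SamplingMechanism.

(** * The uniform mixture over both rules and all splits *)

Lemma In_map_seq (T U : Type) (f : T -> U) s y :
  List.In y (map f s) -> exists x, y = f x.
Proof. by elim: s => //= x s IHs [<-|/IHs //]; exists x. Qed.

Theorem theorem3p11 (R : realType) (n m : nat) :
  exists D : randmech R n m,
    is_distribution D /\ universally_OSP D /\ approximation 400 D.
Proof.
pose rule b := if b then @posted_rule R n m else @fee_rule R n m.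
pose w : R := #|{: bool * {set 'I_n}}|%:R^-1.
pose N : R := #|{set 'I_n}|%:R.
have N0 : 0 < N by rewrite ltr0n; apply/card_gt0P; exists set0.
have wN : w = (2 * N)^-1 by rewrite /w card_prod card_bool natrM.
have w0 : 0 < w by rewrite wN invr_gt0 mulr_gt0.
exists [seq (w, sampling_mech (rule x.1) x.2) | x <- enum {: bool * {set 'I_n}}].
split; [split|split].
- by move=> e eD; have [x ->] := In_map_seq eD; apply: ltW.
- rewrite big_map big_enum /= sumr_const -mulr_natl mulfV //.
  by rewrite -invr_eq0 -/w gt_eqF.
- move=> e eD _; have [[[] S] ->] := In_map_seq eD; apply: sampling_mech_OSP.
    exact: posted_rule_sample_based.
  exact: fee_rule_sample_based.
- move=> v dmv; rewrite /expected_welfare big_map big_enum /= -mulr_sumr.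
  have -> : \sum_(x : bool * {set 'I_n})
        welfare_of (sampling_mech (rule x.1) x.2) v =
      \sum_S welfare_of (sampling_mech (@posted_rule R n m) S) v
      + \sum_S welfare_of (sampling_mech (@fee_rule R n m) S) v.
    by rewrite -(pair_bigA _ (fun b S =>
      welfare_of (sampling_mech (rule b) S) v)) /= big_bool.
  set E := _ + _.
  have E0 : 0 <= E.
    apply: addr_ge0; apply: sumr_ge0 => S _;
      by rewrite sampling_mech_welfare sold_ge0.
  apply: bigmax_le => [|o fo]; first by rewrite !mulr_ge0 // ltW.
  (* The expected welfare is [E / (2 * N)], so the bound by [32 * E / N] gives the factor 64, within
     400. *)
  have := sampling_welfare dmv fo; rewrite -/N -/E mulrC -ler_pdivlMr //.
  move=> /le_trans; apply; rewrite wN invfM.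
  have : 0 <= N^-1 * E by rewrite mulr_ge0 // invr_ge0 ltW.
  by rewrite -!mulrA [E * _]mulrC; lra.
Qed.
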